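(* Let $d$ be a positive integer and let $(\mathcal X,\mathcal T,g)$ be a finite or countable (possibly non-compact) $n$-dimensional $d$-degenerate indefinite metric polyhedron. Then: (1) There exists a simplicial isometric map of $\mathcal X$ into the Minkowski space $\mathbb R^d_d$. (2) In addition, assume that $d\ge 2n+1$. Then there exists a simplicial isometric embedding of $\mathcal X$ into $\mathbb R^d_d$.
   Context: An indefinite metric polyhedron is a simplicial complex endowed with a bilinear form attached to every simplex; the forms must agree on the intersections of simplices and are not assumed to be positive-definite or even non-degenerate. For any edge ($1$-simplex), the value of the bilinear form on this edge is called its squared length. The squared lengths of the edges can be arbitrary real numbers (including negative ones), and they completely determine the bilinear forms. Accordingly, an indefinite metric polyhedron is denoted by a triple $(\mathcal X,\mathcal T,g)$, where $(\mathcal X,\mathcal T)$ is the simplicial complex and $g:E(\mathcal T)\to\mathbb R$ is the function associating a squared length to every edge, $E(\mathcal T)$ being the set of edges of $\mathcal T$. All indefinite metric polyhedra are assumed to be finite or countable. The Minkowski space $\mathbb R^d_d$ is the vector space $\mathbb R^{2d}=\{v=(v^+,v^-): v^+,v^-\in\mathbb R^d\}$ endowed with the pseudoscalar product $\langle v,u\rangle_{\mathbb R^d_d}=\langle v^+,u^+\rangle_{\mathbb R^d}-\langle v^-,u^-\rangle_{\mathbb R^d}$, where $\langle\cdot,\cdot\rangle_{\mathbb R^d}$ is the standard scalar product of $\mathbb R^d$. A simplicial map of $\mathcal X$ into $\mathbb R^d_d$ is a map that is affine on every simplex; it is completely determined by the images of the vertices. A simplicial isometric map is a simplicial map $f$ such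 that the bilinear form of every simplex equals the pull-back of $\langle\cdot,\cdot\rangle_{\mathbb R^d_d}$ along $f$; equivalently, for every edge $e$ with endpoints $a,b$ one has $\langle f(a)-f(b),f(a)-f(b)\rangle_{\mathbb R^d_d}=g(e)$. A simplicial isometric embedding is an injective simplicial isometric map. For a positive integer $k$, a finite or countable graph is called $k$-degenerate if every subgraph of it has a vertex of degree at most $k$. (The authors add, as an equivalent formulation, that the vertices of the graph can be ordered so that each vertex has at most $k$ neighbors that are earlier in the ordering.) An indefinite metric polyhedron is $d$-degenerate if its $1$-dimensional skeleton is a $d$-degenerate graph. *)

(* Defs.v *)
From mathcomp Require Import all_boot all_order all_algebra.
From mathcomp Require Import finmap.
From mathcomp Require Import all_classical all_reals.

Set Implicit Arguments.
Unset Strict Implicit.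
Unset Printing Implicit Defensive.

Import Order.TTheory GRing.Theory Num.Theory.
Local Open Scope fset_scope.
Local Open Scope ring_scope.

(* "Every subgraph" is read as "every finite nonempty subgraph", the usual
   notion of degeneracy for infinite graphs.  By compactness it is equivalent
   to the existence of a linear order in which every vertex has at most k
   earlier neighbours, whereas allowing infinite subgraphs gives a strictly
   stronger condition: the 3-regular tree is 1-degenerate for the ordering
   formulation but has no vertex of degree at most 1.
   The subgraph is (W, h restricted to W). *)
Definition degenerate (V : choiceType) (k : nat) (e : rel V) : Prop :=
  forall (W : {fset V}) (h : rel V),
    W != fset0 -> symmetric h -> subrel h e ->
    exists2 v, v \in W & (#|` [fset w in W | h v w]| <= k)%N.

(* Finite and countable complexes are obtained by letting V range over
   countable types; V is exactly the vertex set. *)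
Record complex (V : choiceType) := Complex {
  simplices :> {pred {fset V}};
  simplices_neq0 : fset0 \notin simplices;
  simplices_vertex : forall v, [fset v] \in simplices;
  simplices_face : forall S S' : {fset V},
    S \in simplices -> S' `<=` S -> S' != fset0 -> S' \in simplices
}.

Definition skeleton1 (V : choiceType) (K : complex V) : rel V :=
  fun a b => (a != b) && ([fset a; b] \in K).

Definition dimensional (V : choiceType) (n : nat) (K : complex V) : Prop :=
  (forall S, S \in K -> (#|` S| <= n.+1)%N) /\
  (exists2 S, S \in K & #|` S| = n.+1).

(* Points are given by their barycentric coordinates. *)
Definition closed_simplex (R : realType) (V : choiceType) (S : {fset V}) :
    set (V -> R) :=
  [set x | [/\ forall v, v \notin S -> x v = 0, forall v, 0 <= x v
             & \sum_(v <- S) x v = 1]].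

Definition realization (R : realType) (V : choiceType) (K : complex V) :
    set (V -> R) :=
  [set x | exists2 S, S \in K & closed_simplex S x].

Definition vertex (R : realType) (V : choiceType) (v : V) : V -> R :=
  fun w => (w == v)%:R.

(* The vector space of the differences of points of the affine span of S. *)
Definition tangent (R : realType) (V : choiceType) (S : {fset V}) :
    set (V -> R) :=
  [set u | (forall v, v \notin S -> u v = 0) /\ \sum_(v <- S) u v = 0].

(* [form S] is meaningful on [tangent S] only.  The squared length of an edge
   ab is the value of [form [fset a; b]] at (u, u), u = vertex b - vertex a;
   it is not recorded separately, since the squared lengths of the edges are
   arbitrary and determine the forms: for tangent u and w,
   form S u w = - (1 / 2) * \sum_(a, b in S) g(ab) * u a * w b. *)
Record metric_polyhedron (R : realType) (V : choiceType) := MetricPolyhedron {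
  underlying :> complex V;
  form : {fset V} -> (V -> R) -> (V -> R) -> R;
  form_sym : forall S u w, S \in underlying -> tangent S u -> tangent S w ->
    form S u w = form S w u;
  form_linear : forall S (t : R) u u' w, S \in underlying ->
    tangent S u -> tangent S u' -> tangent S w ->
    form S (fun v => t * u v + u' v) w = t * form S u w + form S u' w;
  form_compat : forall S S' u w, S \in underlying -> S' \in underlying ->
    tangent (S `&` S') u -> tangent (S `&` S') w ->
    form S u w = form S' u w
}.

(* A vector v of the Minkowski space is the pair of v.1 = v^+ and v.2 = v^-. *)
Notation minkowski R d := ('rV[R]_d * 'rV[R]_d)%type.

Definition pseudoscalar (R : realType) (d : nat)
    (v u : minkowski R d) : R :=
  \sum_i v.1 0 i * u.1 0 i - \sum_i v.2 0 i * u.2 0 i.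

Section Maps.
Variables (R : realType) (V : choiceType) (d : nat).
Implicit Types (F : (V -> R) -> minkowski R d) (S : {fset V}).

(* Only the values of F on [realization K] matter, here and below. *)
Definition simplicial_map (K : complex V) F : Prop :=
  forall S x y (t : R), S \in K -> closed_simplex S x -> closed_simplex S y ->
    0 <= t <= 1 ->
    F (fun v => t * x v + (1 - t) * y v) = t *: F x + (1 - t) *: F y.

(* The linear part on [tangent S] of a map F that is affine on S. *)
Definition linear_part S F (u : V -> R) : minkowski R d :=
  \sum_(v <- S) u v *: F (vertex R v).

Definition pullback S F (u w : V -> R) : R :=
  pseudoscalar (linear_part S F u) (linear_part S F w).

Definition simplicial_isometric_map (X : metric_polyhedron R V) F : Prop :=
  simplicial_map X F /\
  forall S u w, S \in X -> tangent S u -> tangent S w ->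
    form X S u w = pullback S F u w.

Definition simplicial_isometric_embedding (X : metric_polyhedron R V) F :
    Prop :=
  simplicial_isometric_map X F /\ set_inj (realization (R := R) X) F.

End Maps.

(* Main.v *)
Require Import Defs.
From mathcomp Require Import all_boot all_order all_algebra.
From mathcomp Require Import finmap ring.
From mathcomp Require Import all_classical all_reals.

(** In the null coordinates x = v^+ + v^- and y = v^+ - v^- the squared length
    of a vector of the Minkowski space is the scalar product of x and y.  So if
    the first coordinates x_a of the images of the vertices are fixed in
    advance, the condition that an edge ab have squared length g(ab),

      (x_a - x_b) . (y_a - y_b) = g(ab),

    is linear in the unknown second coordinates.  Put the x_a on the moment
    curve (t, t^2, ..., t^d), at distinct parameters, so that any d + 1 of them
    are affinely independent ([powers_independent]).  A linear relation between
    the left-hand sides of finitely many equations is an equilibrium stress on a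
    finite subgraph.  Such a subgraph has a vertex with at most d neighbours,
    where equilibrium forces the stress to vanish
    ([degenerate_no_self_stress]).  Hence every finite subsystem is consistent
    for every right-hand side, and a linear system with countably many unknowns
    and finitely many of them in each equation is solvable as soon as no
    finite combination of its equations is contradictory
    ([finitely_consistent_system_solvable]).

    The simplicial map given by the solution is isometric, as the form of a
    simplex is determined by the squared lengths of its edges
    ([form_determined_by_edges]).  If d >= 2n + 1, two simplices have at most
    d + 1 vertices together, so the x-coordinates alone separate the points of
    the polyhedron ([moment_coordinates_injective]): the same map is an
    embedding. *)

(** * Infinite linear systems with finitely supported equations *)
Section LinearSystem.
Import GRing.Theory.
Local Open Scope ring_scope.

(** On the finitely supported sequences of its domain, the linear functional
    [Phi] extends to the space of all finitely supported sequences.  The values y_0, y_1, ...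
    of the extension are chosen in turn: y_N is forced as soon as some u in the
    subspace has N as its last index, and two such u force the same value
    because a combination of them is supported below N. *)
Lemma linear_relation_extends (K : fieldType)
    (Phi : (nat -> K) -> K -> Prop)
    (lin : forall t u c u' c', Phi u c -> Phi u' c' ->
       Phi (fun i => t * u i + u' i) (t * c + c'))
    (functional : forall u c, Phi u c -> (forall i, u i = 0) -> c = 0) :
  exists y : nat -> K, forall N u c, Phi u c ->
    (forall i, (N <= i)%N -> u i = 0) -> c = \sum_(i < N) u i * y i.
Proof.
pose good N (y : nat -> K) := forall u c, Phi u c ->
  (forall i, (N <= i)%N -> u i = 0) -> c = \sum_(i < N) u i * y i.
pose set_at (N : nat) z (y : nat -> K) (i : nat) := if i == N then z else y i.
pose step N y : nat -> K :=
  set_at N (xget 0 [set z | good N.+1 (set_at N z y)]%classic) y.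
pose yy := fix yy N := if N is M.+1 then step M (yy M) else fun=> 0.
have sum_set N z y (u : nat -> K) : \sum_(i < N.+1) u i * set_at N z y i =
    \sum_(i < N) u i * y i + u N * z.
  rewrite big_ord_recr /= /set_at eqxx; congr (_ + _).
  by apply: eq_bigr => i _; rewrite ltn_eqF.
have goodyy N : good N (yy N).
  elim: N => [|N IH] u0 c0 Phi0 supp0.
    by rewrite big_ord0; apply: (functional _ _ Phi0) => i; apply: supp0.
  rewrite /= /step.
  suff ex : exists z, good N.+1 (set_at N z (yy N)) by apply: (xgetPex 0 ex).
  (* The relation puts a condition on y_N only if its domain contains a v whose
     last index is N; otherwise any value will do. *)
  have [[v [e [Phiv suppv vN]]]|nov] := pselect (exists v e,
      [/\ Phi v e, forall i, (N < i)%N -> v i = 0 & v N != 0]); last first.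
    exists 0 => u c Phiu supp; rewrite sum_set mulr0 addr0.
    apply: (IH _ _ Phiu) => i; rewrite leq_eqVlt => /predU1P[<-|]; last exact: supp.
    by apply: contrapT => /eqP uN; apply: nov; exists u, c.
  exists ((e - \sum_(i < N) v i * yy N i) / v N) => u c Phiu supp.
  rewrite sum_set.
  have := IH _ _ (lin (- (u N / v N)) _ _ _ _ Phiv Phiu) _.
  have -> : \sum_(i < N) (- (u N / v N) * v i + u i) * yy N i =
      - (u N / v N) * (\sum_(i < N) v i * yy N i) + \sum_(i < N) u i * yy N i.
    by rewrite mulr_sumr -big_split; apply: eq_bigr => i _ /=; ring.
  move=> IH'.
  have {IH'} : - (u N / v N) * e + c =
      - (u N / v N) * (\sum_(i < N) v i * yy N i) + \sum_(i < N) u i * yy N i.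
    apply: IH' => i; rewrite leq_eqVlt => /predU1P[<-|lt].
      by field.
    by rewrite (suppv i) // (supp i) // mulr0 addr0.
  by move=> /(canRL (addKr _)) ->; field.
exists (fun i => yy i.+1 i) => N u c Phiu supp.
rewrite (goodyy N _ _ Phiu supp); apply: eq_bigr => -[i /= iN] _; congr (_ * _).
elim: N iN {supp} => // N IH; rewrite ltnS leq_eqVlt => /predU1P[->//|lt].
by rewrite -IH //= /step /set_at ltn_eqF.
Qed.

(** Compactness for linear systems: equations in countably many unknowns, each
    involving finitely many of them, have a common solution if no finite
    combination of them reads 0 = c with c nonzero.  An equation is stored as
    the formal combination [row e] of unknowns, in which an unknown may occur
    several times. *)
Lemma finitely_consistent_system_solvable (K : fieldType) (I : countType)
    (E : Type) (row : E -> seq (K * I)) (b : E -> K)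
    (consistent : forall s : seq (K * E),
      (forall i, \sum_(p <- s) p.1 *
         (\sum_(q <- row p.2) q.1 * (q.2 == i)%:R) = 0) ->
      \sum_(p <- s) p.1 * b p.2 = 0) :
  exists y : I -> K, forall e, \sum_(q <- row e) q.1 * y q.2 = b e.
Proof.
pose coef e n : K := \sum_(q <- row e) q.1 * (choice.pickle q.2 == n)%:R.
pose Phi (u : nat -> K) c := exists s : seq (K * E),
  (forall n, u n = \sum_(p <- s) p.1 * coef p.2 n) /\
  c = \sum_(p <- s) p.1 * b p.2.
have [||y Hy] := @linear_relation_extends K Phi.
- move=> t u c u' c' [s [us ->]] [s' [us' ->]].
  exists ([seq (t * p.1, p.2) | p <- s] ++ s'); split=> [n|];
    rewrite big_cat big_map ?us ?us' mulr_sumr; congr (_ + _);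
    by apply: eq_bigr => p _; rewrite mulrA.
- move=> u c [s [us ->]] u0; apply: consistent => i.
  rewrite -[RHS](u0 (choice.pickle i)) us; apply: eq_bigr => p _; congr (_ * _).
  by apply: eq_bigr => q _; rewrite (inj_eq (pcan_inj choice.pickleK)).
exists (fun i => y (choice.pickle i)) => e.
pose N := \max_(q <- row e) (choice.pickle q.2).+1.
have leN q : q \in row e -> (choice.pickle q.2 < N)%N.
  by move=> qe; apply: (leq_bigmax_seq (F := fun q => (choice.pickle q.2).+1)).
rewrite [RHS](Hy N (coef e)).
- rewrite (eq_bigr _ (fun i _ => mulr_suml _ _ _ _)) exchange_big /=.
  rewrite big_seq [RHS]big_seq; apply: eq_bigr => q qe.
  rewrite (bigD1 (Ordinal (leN q qe))) //= eqxx mulr1 big1 ?addr0 // => i.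
  by rewrite -val_eqE /= eq_sym => /negPf->; rewrite mulr0 mul0r.
- exists [:: (1, e)]; split=> [n|]; by rewrite big_seq1 mul1r.
- move=> i Ni; apply: big1_seq => q /= qe.
  by rewrite ltn_eqF ?mulr0 //; apply: leq_trans Ni; apply: leN.
Qed.

End LinearSystem.

(** * General position of points on the moment curve *)
Section MomentCurve.
Import GRing.Theory.
Local Open Scope ring_scope.
Local Open Scope fset_scope.

(** At most d + 1 points (t, t^2, ..., t^d) are affinely independent: the
    hypothesis says that r annihilates all polynomials of degree at most d, and
    one of these vanishes at all the points but one. *)
Lemma powers_independent (K : fieldType) (V : choiceType) (d : nat)
    (t : V -> K) (T : {fset V}) (r : V -> K)
    (t_inj : injective t) (leT : (#|` T| <= d.+1)%N)
    (moments0 : forall k, (k <= d)%N -> \sum_(v <- T) r v * t v ^+ k = 0) :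
  forall v, v \in T -> r v = 0.
Proof.
move=> v vT.
pose p : {poly K} := \prod_(w <- T `\ v) ('X - (t w)%:P).
have szp : (size p <= d.+1)%N.
  rewrite /p size_prod_XsubC.
  by apply: leq_trans leT; rewrite (cardfsD1 v T) vT.
have : \sum_(w <- T) r w * p.[t w] = 0.
  rewrite (eq_bigr (fun w => \sum_(k < d.+1) p`_k * (r w * t w ^+ k))).
    rewrite exchange_big big1 // => k _.
    by rewrite -mulr_sumr moments0 ?mulr0 // -ltnS.
  move=> w _; rewrite (horner_coef_wide _ szp) mulr_sumr.
  by apply: eq_bigr => k _; ring.
rewrite (big_fsetD1 v) //= big1_fset => [|w wT _].
  rewrite addr0 => /eqP; rewrite mulf_eq0 => /predU1P[//|].
  rewrite horner_prod prodf_seq_eq0 => /hasP[w /=].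
  rewrite !inE => /andP[wv _]; rewrite hornerXsubC subr_eq0 => /eqP/t_inj vw.
  by rewrite vw eqxx in wv.
have -> : p.[t w] = 0; last by rewrite mulr0.
apply/eqP; rewrite horner_prod prodf_seq_eq0; apply/hasP; exists w => //=.
by rewrite hornerXsubC subrr.
Qed.

End MomentCurve.

(** * Stresses of degenerate graphs and edge equations *)
Section Stress.
Import GRing.Theory Num.Theory.
Local Open Scope ring_scope.

Lemma sum_indicator {K : pzSemiRingType} {V : choiceType} {W : {fset V}}
    (a : V) (G : V -> K) (aW : a \in W) :
  \sum_(v <- W) (v == a)%:R * G v = G a.
Proof.
rewrite (big_fsetD1 a) //= eqxx mul1r big1_fset ?addr0 // => v.
by rewrite in_fsetD1 => /andP[/negPf-> _]; rewrite mul0r.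
Qed.

(** Independence of degenerate graphs in the generic rigidity matroid.  Let the
    vertices lie on the moment curve and let the edge weights [C] be in
    equilibrium at every vertex.  Some vertex v of the support of [C] has at
    most d neighbours there; with v these are at most d + 1 points in general
    position, so the edges at v are linearly independent and their weights
    vanish, a contradiction. *)
Lemma degenerate_no_self_stress (K : fieldType) (V : choiceType) (d : nat)
    (e : rel V) (t : V -> K) (W : {fset V}) (C : V -> V -> K)
    (e_irr : irreflexive e) (e_deg : degenerate d e) (t_inj : injective t)
    (C_sym : forall v w, C v w = C w v)
    (C_edge : forall v w, C v w != 0 -> e v w)
    (equilibrium : forall v k, (k < d)%N ->
       \sum_(w <- W) C v w * (t v ^+ k.+1 - t w ^+ k.+1) = 0) :
  forall v w, v \in W -> w \in W -> C v w = 0.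
Proof.
pose U := [fset v in W | has (fun w => C v w != 0) W]%fset.
pose h v w := C v w != 0.
suff U0 : U = fset0.
  move=> v w vW wW; apply: contrapT => /eqP Cvw.
  suff : v \in U by rewrite U0 inE.
  by rewrite !inE /= vW; apply/hasP; exists w.
apply: contrapT => /eqP U0.
have h_sym : symmetric h by move=> v w; rewrite /h C_sym.
have [v vU degv] := e_deg U h U0 h_sym C_edge.
move: vU; rewrite !inE /= => /andP[vW /hasP[w0 w0W Cvw0]].
set N := [fset w in U | h v w]%fset in degv.
have inN w : w \in W -> C v w != 0 -> w \in N.
  move=> wW Cvw; rewrite !inE /= wW /h Cvw andbT; apply/hasP; exists v => //.
  by rewrite C_sym.
have vN : v \notin N.
  by rewrite !inE /= /h; apply/negP => /andP[_ /C_edge]; rewrite e_irr.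
(* The equilibrium at v, as an affine dependence between v and its neighbours:
   the weight of v is chosen so that the total weight is 0. *)
pose r u := if u == v then \sum_(w <- N) C v w else - C v u.
have rN w : w \in N -> r w = - C v w.
  by rewrite /r; case: eqP => // -> vN'; rewrite vN' in vN.
have moments k : (k <= d)%N -> \sum_(u <- (v |` N)%fset) r u * t u ^+ k = 0.
  move=> kd; rewrite big_fsetU1 //= {1}/r eqxx mulr_suml /=.
  rewrite [X in _ + X](eq_big_seq (fun w => - (C v w * t w ^+ k))) => [|w wN /=];
    last by rewrite rN // mulNr.
  rewrite -big_split /=.
  case: k kd => [_|k kd]; first by apply: big1 => w _; rewrite subrr.
  rewrite -[RHS](equilibrium v k kd).
  rewrite -(@big_fset_incl _ _ _ _ N W).
  - by apply: eq_bigr => w _; rewrite mulrBr.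
  - by apply/fsubsetP => w; rewrite !inE /= => /andP[/andP[]].
  - move=> w wW wN; suff -> : C v w = 0 by rewrite mul0r.
    by apply: contrapT => /eqP /(inN w wW); apply/negP.
have cardT : (#|` (v |` N)%fset| <= d.+1)%N by rewrite cardfsU1 vN.
have w0N := inN w0 w0W Cvw0.
have := powers_independent _ _ _ _ _ _ t_inj cardT moments w0 _.
rewrite rN // in_fset1U w0N orbT => /(_ isT) /eqP; rewrite oppr_eq0.
exact/negP.
Qed.

(** For fixed first null coordinates (t, t^2, ..., t^d), the prescription of
    the squared lengths is a linear system for the second null coordinates [y].
    A linear relation between its rows is a self-stress of a finite subgraph,
    hence trivial; so any finite subsystem, and therefore the whole system, is
    consistent.  A vertex by vertex construction would instead require an
    enumeration of V in which every vertex has at most d earlier neighbours, and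
    degeneracy of the finite subgraphs does not provide one. *)
Lemma degenerate_edge_equations_solvable (K : numFieldType) (V : countType)
    (d : nat) (e : rel V) (t : V -> K) (g : V -> V -> K)
    (e_sym : symmetric e) (e_irr : irreflexive e) (e_deg : degenerate d e)
    (t_inj : injective t) (g_sym : forall a b, g a b = g b a) :
  exists y : V -> 'I_d -> K, forall a b, e a b ->
    \sum_(k < d) (t a ^+ k.+1 - t b ^+ k.+1) * (y a k - y b k) = g a b.
Proof.
pose E := {p : V * V | e p.1 p.2}.
pose x (v : V) (k : 'I_d) := t v ^+ k.+1.
pose row (p : E) : seq (K * (V * 'I_d)) :=
  [seq (x (val p).1 k - x (val p).2 k, ((val p).1, k)) | k : 'I_d] ++
  [seq (x (val p).2 k - x (val p).1 k, ((val p).2, k)) | k : 'I_d].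
have rowE (p : E) (z : V * 'I_d -> K) : \sum_(q <- row p) q.1 * z q.2 =
    \sum_(k < d) (x (val p).1 k - x (val p).2 k) *
           (z ((val p).1, k) - z ((val p).2, k)).
  rewrite big_cat !big_image /= -big_split.
  by apply: eq_bigr => k _ /=; ring.
pose b (p : E) := g (val p).1 (val p).2.
have [|y Hy] := @finitely_consistent_system_solvable K _ E row b; last first.
  exists (fun v k => y (v, k)) => v w vw.
  by have := Hy (exist _ (v, w) vw); rewrite rowE.
move=> s relation.
pose W := [fset v in
  [seq (val p.2).1 | p <- s] ++ [seq (val p.2).2 | p <- s]]%fset.
have inW p : p \in s -> ((val p.2).1 \in W) * ((val p.2).2 \in W).
  move=> ps; split; rewrite !inE /=; apply/orP; [left|right];
    by apply/mapP; exists p.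
(* An edge occurs in the system once for each of its two orientations; the stress
   adds the coefficients of both. *)
pose C v w := \sum_(p <- s)
  p.1 * ((val p.2 == (v, w))%:R + (val p.2 == (w, v))%:R).
have pick2 (p : E) (G : V -> V -> K) :
    (val p).1 \in W -> (val p).2 \in W ->
    \sum_(v <- W) \sum_(w <- W) (val p == (v, w))%:R * G v w =
    G (val p).1 (val p).2.
  move=> p1 p2; rewrite -[RHS](sum_indicator _ (fun v => G v (val p).2) p1).
  apply: eq_bigr => v _; rewrite -(sum_indicator _ (G v) p2) mulr_sumr.
  apply: eq_bigr => w _; rewrite mulrA -natrM mulnb; congr (_%:R * _).
  by rewrite -pair_eqE /= (eq_sym v) (eq_sym w).
have C0 v w : v \in W -> w \in W -> C v w = 0.
  apply: (degenerate_no_self_stress _ _ _ _ _ _ _ e_irr e_deg t_inj).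
  - by move=> {}v {}w; apply: eq_bigr => p _; rewrite addrC.
  - move=> {}v {}w; apply: contraR => nvw; apply/eqP; apply: big1 => p _.
    have ne a c : ~~ e a c -> (val p.2 == (a, c)) = false.
      by move=> nac; apply: contraNF nac => /eqP Ep; have := valP p.2; rewrite Ep.
    by rewrite !ne ?addr0 ?mulr0 // e_sym.
  - move=> {w} {}v k kd.
    rewrite -[RHS](relation (v, Ordinal kd)).
    rewrite (eq_bigr _ (fun w _ => mulr_suml _ _ _ _)) exchange_big /=.
    rewrite big_seq [RHS]big_seq; apply: eq_bigr => p /inW[p1 p2].
    rewrite (rowE _ (fun q => (q == _)%:R)).
    rewrite (bigD1 (Ordinal kd)) //= [X in _ = _ * (_ + X)]big1 => [|i ik]; last first.
      by rewrite -!pair_eqE /= (negPf ik) !andbF subrr mulr0.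
    rewrite -!pair_eqE /= eqxx !andbT addr0.
    set a := (val p.2).1 in p1 *; set c := (val p.2).2 in p2 *.
    transitivity (p.1 * ((a == v)%:R * (t v ^+ k.+1 - t c ^+ k.+1) +
                         (c == v)%:R * (t v ^+ k.+1 - t a ^+ k.+1))).
      rewrite -(sum_indicator _ (fun w =>
          (a == v)%:R * (t v ^+ k.+1 - t w ^+ k.+1)) p2).
      rewrite -(sum_indicator _ (fun w =>
          (c == v)%:R * (t v ^+ k.+1 - t w ^+ k.+1)) p1).
      rewrite -big_split mulr_sumr; apply: eq_bigr => w _ /=.
      by rewrite -!mulnb !natrM !(eq_sym w); ring.
    rewrite /x /=; case: (a =P v) => [->|_]; case: (c =P v) => [->|_] /=; ring.
(* Summing [C] against [g] over ordered pairs counts every equation twice. *)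
suff : (\sum_(p <- s) p.1 * b p.2) *+ 2 = 0.
  by move=> /eqP; rewrite mulrn_eq0 /= => /eqP.
transitivity (\sum_(v <- W) \sum_(w <- W) C v w * g v w); last first.
  by apply: big1_fset => v vW _; apply: big1_fset => w wW _; rewrite C0 ?mul0r.
rewrite -sumrMnl /C.
under [RHS]eq_bigr => v _ do
  (rewrite (eq_bigr _ (fun w _ => mulr_suml _ _ _ _)) exchange_big /=).
rewrite [RHS]exchange_big big_seq [RHS]big_seq; apply: eq_bigr => p /inW[p1 p2].
under [RHS]eq_bigr => v _ do 
  (under eq_bigr => w _ do rewrite -mulrA mulrDl mulrDr).
under [RHS]eq_bigr => v _ do rewrite big_split -!mulr_sumr.
rewrite big_split -!mulr_sumr /= mulr2n pick2 //; congr (_ + _ * _).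
rewrite exchange_big /= (pick2 _ (fun v w => g w v)) //.
Qed.
End Stress.

(** * Forms on a simplex are determined by the squared lengths of its edges *)
Section Polarization.
Import GRing.Theory Num.Theory.
Local Open Scope ring_scope.
Context {R : realType} {V : choiceType}.
Implicit Types (S : {fset V}) (u w : V -> R).

Definition edge_vector (a b : V) : V -> R :=
  fun v => vertex R a v - vertex R b v.

Lemma tangent_combination S (c : R) u u' :
  tangent S u -> tangent S u' -> tangent S (fun v => c * u v + u' v).
Proof.
move=> [u0 su] [u'0 su']; split.
  by move=> v vS; rewrite u0 // u'0 // mulr0 addr0.
by rewrite big_split -mulr_sumr /= su su' mulr0 addr0.
Qed.

Lemma tangent0 S : tangent S (fun=> 0 : R).
Proof. by split=> //; apply: big1. Qed.

Lemma tangent_edge_vector S a b :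
  a \in S -> b \in S -> tangent S (edge_vector a b).
Proof.
move=> aS bS; split=> [v vS|].
  rewrite /edge_vector /vertex.
  by rewrite !(eq_sym v) (negPf (memPn vS a aS)) (negPf (memPn vS b bS)) subrr.
have sum1 a' : a' \in S -> \sum_(v <- S) vertex R a' v = 1.
  move=> a'S; rewrite -[RHS](sum_indicator a' (fun=> 1) a'S).
  by apply: eq_bigr => v _; rewrite mulr1.
by rewrite sumrB !sum1 ?subrr.
Qed.

Lemma tangent_decomposition S u o : o \in S -> tangent S u ->
  u = fun v => \sum_(a <- S) u a * edge_vector a o v.
Proof.
move=> oS [u0 su]; apply: funext => v; rewrite /edge_vector /vertex.
rewrite (eq_bigr _ (fun a _ => mulrBr _ _ _)) sumrB -mulr_suml su mul0r subr0.
case: (boolP (v \in S)) => vS.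
  rewrite -[LHS](sum_indicator v u vS); apply: eq_bigr => a _.
  by rewrite mulrC eq_sym.
rewrite u0 // big1_fset // => a aS _.
by rewrite eq_sym (negPf (memPn vS a aS)) mulr0.
Qed.

Section Form.
Variables (S : {fset V}) (B : (V -> R) -> (V -> R) -> R).
Hypothesis B_sym : forall u w, tangent S u -> tangent S w -> B u w = B w u.
Hypothesis B_linear : forall (c : R) u u' w,
  tangent S u -> tangent S u' -> tangent S w ->
  B (fun v => c * u v + u' v) w = c * B u w + B u' w.

Lemma form0 w : tangent S w -> B (fun=> 0) w = 0.
Proof.
move=> Tw; have := B_linear 1 _ _ _ (tangent0 S) (tangent0 S) Tw.
rewrite (_ : (fun _ => _) = (fun=> 0)); last first.
  by apply: funext => v; rewrite mulr0 addr0.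
by rewrite mul1r => /eqP; rewrite -subr_eq subrr eq_sym => /eqP.
Qed.

Lemma form_edge_swap a b : a \in S -> b \in S ->
  B (edge_vector a b) (edge_vector a b) = B (edge_vector b a) (edge_vector b a).
Proof.
move=> aS bS; have T c c' := tangent_edge_vector S c c'.
have E : edge_vector a b = fun v => -1 * edge_vector b a v + 0.
  by apply: funext => v; rewrite /edge_vector; ring.
have flip w : tangent S w -> B (edge_vector a b) w = - B (edge_vector b a) w.
  by move=> Tw; rewrite E B_linear ?form0 ?addr0 ?mulN1r //;
    [exact: T|exact: tangent0].
rewrite flip; last exact: T.
by rewrite B_sym ?flip ?opprK //; apply: T.
Qed.

(** Bilinearity is only available for tangent vectors, so tangency of the
    partial sums of the expansion of [u] is carried along the induction. *)
Lemma form_vanishes_on_generators u w o : o \in S ->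
  tangent S u -> tangent S w ->
  (forall a, a \in S -> B (edge_vector a o) w = 0) -> B u w = 0.
Proof.
move=> oS Tu Tw gen0.
rewrite (tangent_decomposition _ _ _ oS Tu).
suff partial_sums : forall s : seq V, {subset s <= S} ->
  tangent S (fun v => \sum_(a <- s) u a * edge_vector a o v) /\
  B (fun v => \sum_(a <- s) u a * edge_vector a o v) w = 0.
  by case: (partial_sums S (fun _ => id)).
elim=> [_|a s IH sub].
  rewrite (_ : (fun _ => _) = (fun=> 0)); first
    by split; [apply: tangent0|apply: form0].
  by apply: funext => v; rewrite big_nil.
have aS : a \in S by apply: sub; rewrite mem_head.
have [|Ts Bs] := IH; first by move=> v vs; apply: sub; rewrite inE vs orbT.
have Ta := tangent_edge_vector _ _ _ aS oS.
rewrite (_ : (fun _ => _) = (fun v => u a * edge_vector a o v +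
    \sum_(a <- s) u a * edge_vector a o v)); last first.
  by apply: funext => v; rewrite big_cons.
split; first exact: tangent_combination.
by rewrite B_linear // gen0 // Bs mulr0 addr0.
Qed.

(** Polarization: if e_a and e_b are the edge vectors from a vertex o to a
    and b, then e_b - e_a is an edge vector too, so that 2 B(e_a, e_b) is a
    combination of squared lengths; and the e_a span the tangent space. *)
Lemma form_determined_by_edges u w : S != fset0 ->
  tangent S u -> tangent S w ->
  (forall a b, a \in S -> b \in S -> a != b ->
     B (edge_vector a b) (edge_vector a b) = 0) ->
  B u w = 0.
Proof.
move=> /fset0Pn[o oS] Tu Tw edges.
have T a b := tangent_edge_vector S a b.
have edge0 a b : a \in S -> b \in S ->
    B (edge_vector a b) (edge_vector a b) = 0.
  have [-> bS _|ab aS bS] := eqVneq a b; last exact: edges.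
  rewrite {1}(_ : edge_vector b b = fun=> 0); first by apply: form0; apply: T.
  by apply: funext => v; rewrite /edge_vector subrr.
apply: (form_vanishes_on_generators _ _ _ oS) => // a aS.
rewrite B_sym //; last exact: T.
apply: (form_vanishes_on_generators _ _ _ oS) => // [|b bS]; first exact: T.
have edgeE : edge_vector b a =
    fun v => -1 * edge_vector a o v + edge_vector b o v.
  by apply: funext => v; rewrite /edge_vector; ring.
have := edge0 b a bS aS; rewrite {1}edgeE B_linear; try exact: T.
rewrite (B_sym _ (edge_vector b a)); try exact: T.
rewrite (B_sym (edge_vector b o) (edge_vector b a)); try exact: T.
rewrite edgeE !B_linear; try exact: T.
rewrite (B_sym (edge_vector a o) (edge_vector b o)); try exact: T.
rewrite !edge0 // mulr0 add0r addr0 !mulN1r -opprD => /eqP.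
by rewrite oppr_eq0 -mulr2n mulrn_eq0 /= => /eqP.
Qed.

End Form.
End Polarization.

(** * Null coordinates and simplicial maps into the Minkowski space *)
Section Minkowski.
Import GRing.Theory Num.Theory.
Local Open Scope ring_scope.
Context {R : realType} {V : choiceType} {d : nat}.
Implicit Types (S : {fset V}) (u w : V -> R) (m : minkowski R d).

(** The coordinates v^+ + v^- and v^+ - v^- identify the Minkowski space with
    pairs of vectors (x, y), where the squared length is the scalar product of x
    and y. *)
Definition of_null_coordinates (x y : 'rV[R]_d) : minkowski R d :=
  (2^-1 *: (x + y), 2^-1 *: (x - y)).

Lemma pseudoscalar_null x y x' y' :
  let m := of_null_coordinates x y - of_null_coordinates x' y' in
  pseudoscalar m m =
  \sum_(k < d) (x 0 k - x' 0 k) * (y 0 k - y' 0 k).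
Proof.
rewrite /pseudoscalar /= -sumrB; apply: eq_bigr => k _.
by rewrite !mxE; field.
Qed.

Lemma pseudoscalar_sym m m' : pseudoscalar m m' = pseudoscalar m' m.
Proof.
by congr (_ - _); apply: eq_bigr => k _; rewrite mulrC.
Qed.

Lemma pseudoscalar_linear (c : R) m m' m'' :
  pseudoscalar (c *: m + m') m'' = c * pseudoscalar m m'' + pseudoscalar m' m''.
Proof.
rewrite /pseudoscalar mulrBr !mulr_sumr -!sumrB -big_split.
by apply: eq_bigr => k _ /=; rewrite !mxE; ring.
Qed.

(** A point of the realization has finitely many nonzero coordinates; summing
    over all vertices avoids the choice of a simplex that contains it. *)
Definition barycentric_extension (f : V -> minkowski R d) (p : V -> R) :
    minkowski R d :=
  (\sum_(v \in [set: V]%classic) p v *: f v)%R.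

Lemma barycentric_extensionE f p S : (forall v, v \notin S -> p v = 0) ->
  barycentric_extension f p = \sum_(v <- S) p v *: f v.
Proof.
by move=> p0; apply: fsbigTE => v vS; rewrite p0 // scale0r.
Qed.

Lemma barycentric_extension_vertex f v :
  barycentric_extension f (vertex R v) = f v.
Proof.
rewrite (barycentric_extensionE _ _ [fset v]%fset) => [|w].
  by rewrite big_seq_fset1 /vertex eqxx scale1r.
by rewrite inE /vertex => /negPf->.
Qed.

Lemma barycentric_extension_simplicial (K : complex V) f :
  simplicial_map K (barycentric_extension f).
Proof.
move=> S x y t SK [x0 _ _] [y0 _ _] _.
rewrite !(barycentric_extensionE _ _ S) //; last first.
  by move=> v vS; rewrite x0 // y0 // !mulr0 addr0.
rewrite !scaler_sumr -big_split; apply: eq_bigr => v _ /=.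
by rewrite scalerDl !scalerA.
Qed.

Lemma linear_part_edge S f a b : a \in S -> b \in S ->
  linear_part S (barycentric_extension f) (edge_vector a b) = f a - f b.
Proof.
move=> aS bS; rewrite /linear_part /edge_vector.
have pick c : c \in S -> \sum_(v <- S) vertex R c v *: f v = f c.
  move=> cS; rewrite (big_fsetD1 c) //= /vertex eqxx scale1r.
  rewrite big1_fset ?addr0 // => v.
  by rewrite in_fsetD1 => /andP[/negPf-> _]; rewrite scale0r.
rewrite -(pick a aS) -(pick b bS) -sumrB; apply: eq_bigr => v _.
by rewrite barycentric_extension_vertex scalerBl.
Qed.

Lemma linear_part_linear S (F : (V -> R) -> minkowski R d) (c : R) u u' :
  linear_part S F (fun v => c * u v + u' v) =
  c *: linear_part S F u + linear_part S F u'.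
Proof.
rewrite /linear_part scaler_sumr -big_split; apply: eq_bigr => v _ /=.
by rewrite scalerDl scalerA.
Qed.

End Minkowski.

(** * Isometric maps and embeddings *)
Section Realization.
Import GRing.Theory Num.Theory.
Local Open Scope ring_scope.
Context {R : realType}.

Lemma skeleton1_sym {V : choiceType} (K : complex V) : symmetric (skeleton1 K).
Proof. by move=> a b; rewrite /skeleton1 eq_sym fsetUC. Qed.

Lemma skeleton1_irr {V : choiceType} (K : complex V) :
  irreflexive (skeleton1 K).
Proof. by move=> a; rewrite /skeleton1 eqxx. Qed.

Lemma simplex_neq0 {V : choiceType} {K : complex V} S : S \in K -> S != fset0.
Proof. by apply: contraTneq => ->; apply: simplices_neq0. Qed.

Definition squared_length {V : choiceType} (X : metric_polyhedron R V)
    (a b : V) : R :=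
  Defs.form X [fset a; b]%fset (edge_vector a b) (edge_vector a b).

(** Compatibility of the forms on the common face ab of S and of the edge. *)
Lemma form_edge {V : choiceType} (X : metric_polyhedron R V) S a b :
  S \in X -> a \in S -> b \in S ->
  Defs.form X S (edge_vector a b) (edge_vector a b) = squared_length X a b.
Proof.
move=> SX aS bS.
have abS : ([fset a; b] `<=` S)%fset by rewrite fsubUset !fsub1set aS bS.
have abX : [fset a; b]%fset \in X.
  apply: (simplices_face SX abS).
  by apply/fset0Pn; exists a; rewrite !inE eqxx.
have abI : (S `&` [fset a; b])%fset = [fset a; b]%fset by apply/fsetIidPr.
by apply: form_compat; rewrite // abI;
  apply: tangent_edge_vector; rewrite !inE eqxx ?orbT.
Qed.

Lemma squared_length_sym {V : choiceType} (X : metric_polyhedron R V) a b :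
  [fset a; b]%fset \in X -> squared_length X a b = squared_length X b a.
Proof.
move=> abX.
have [aS bS] : a \in [fset a; b]%fset /\ b \in [fset a; b]%fset.
  by rewrite !inE !eqxx orbT.
rewrite -(form_edge X _ b a abX) //.
apply: (form_edge_swap [fset a; b]%fset) => //.
  by move=> u w; apply: form_sym.
by move=> c u u' w; apply: form_linear.
Qed.

Lemma isometry_of_edges {V : choiceType} {d : nat}
    (X : metric_polyhedron R V) (f : V -> minkowski R d) :
  (forall a b, skeleton1 X a b ->
     pseudoscalar (f a - f b) (f a - f b) = squared_length X a b) ->
  simplicial_isometric_map X (barycentric_extension f).
Proof.
move=> edge_eq; split; first exact: barycentric_extension_simplicial.
move=> S u w SX Tu Tw; apply/eqP; rewrite -subr_eq0; apply/eqP.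
pose B u w := Defs.form X S u w - pullback S (barycentric_extension f) u w.
apply: (form_determined_by_edges S B) => //.
- move=> u' w' Tu' Tw'; rewrite /B form_sym //; congr (_ - _).
  exact: pseudoscalar_sym.
- move=> c u1 u2 w' T1 T2 Tw'; rewrite /B form_linear // /pullback.
  by rewrite linear_part_linear pseudoscalar_linear; ring.
- exact: simplex_neq0 SX.
move=> a b aS bS ab; rewrite /B form_edge // /pullback linear_part_edge //.
rewrite edge_eq ?subrr // /skeleton1 ab.
apply: (simplices_face SX); first by rewrite fsubUset !fsub1set aS bS.
by apply/fset0Pn; exists a; rewrite !inE eqxx.
Qed.

(** Two simplices have at most 2n + 2 <= d + 1 vertices together.  Points with
    the same image have the same first null coordinates, hence are equal by
    affine independence on the moment curve. *)
Lemma moment_coordinates_injective {V : choiceType} {d n : nat}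
    (X : complex V) (t : V -> R) (y : V -> 'rV[R]_d) (t_inj : injective t)
    (dimX : forall S, S \in X -> (#|` S| <= n.+1)%N) (nd : (2 * n + 1 <= d)%N) :
  set_inj (realization (R := R) X) (barycentric_extension (fun v =>
    of_null_coordinates (\row_(k < d) t v ^+ k.+1) (y v))).
Proof.
move=> p q /set_mem[S SX [p0 _ p1]] /set_mem[S' S'X [q0 _ q1]].
set f := (fun v => _); pose T := (S `|` S')%fset.
have sST : (S `<=` T)%fset by apply: fsubsetUl.
have sS'T : (S' `<=` T)%fset by apply: fsubsetUr.
have p0T v : v \notin T -> p v = 0.
  by rewrite inE negb_or => /andP[/p0].
have q0T v : v \notin T -> q v = 0.
  by rewrite inE negb_or => /andP[_ /q0].
rewrite !(barycentric_extensionE _ _ T) // => Epq.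
have coord (r : V -> R) k (kd : (k < d)%N) :
    \sum_(v <- T) r v * t v ^+ k.+1 =
    (\sum_(v <- T) r v *: f v).1 0 (Ordinal kd) +
    (\sum_(v <- T) r v *: f v).2 0 (Ordinal kd).
  pose null (m : minkowski R d) := m.1 0 (Ordinal kd) + m.2 0 (Ordinal kd).
  rewrite -/(null _) (big_morph null (id1 := 0) (op1 := +%R)).
  - by apply: eq_bigr => v _; rewrite /null /= !mxE; field.
  - by move=> m m'; rewrite /null /= !mxE addrACA.
  - by rewrite /null /= !mxE addr0.
have moments k : (k <= d)%N -> \sum_(v <- T) (p v - q v) * t v ^+ k = 0.
  move=> kd; rewrite (eq_bigr _ (fun v _ => mulrBl _ _ _)) sumrB.
  (* The moment of order 0 comes from the normalization of the barycentric
     coordinates, the others from the equality of the images. *)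
  case: k kd => [_|k kd]; last by rewrite !coord // Epq subrr.
  rewrite !(eq_bigr _ (fun v _ => mulr1 _)).
  rewrite -(big_fset_incl _ sST); last by move=> v _; apply: p0.
  rewrite -(big_fset_incl _ sS'T); last by move=> v _; apply: q0.
  by rewrite p1 q1 subrr.
have cardT : (#|` T| <= d.+1)%N.
  apply: leq_trans (leq_trans (_ : _ <= n.+1 + n.+1)%N _); last first.
  - by rewrite addnS ltnS addSn addnn -mul2n -addn1.
  - exact: leq_add (dimX S SX) (dimX S' S'X).
  - by rewrite /T cardfsU leq_subr.
apply: funext => v; case: (boolP (v \in T)) => vT; last by rewrite p0T ?q0T.
apply/eqP; rewrite -subr_eq0; apply/eqP.
exact: (powers_independent _ _ _ _ _ (fun v => p v - q v) t_inj cardT moments).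
Qed.

Definition vertex_parameter {V : countType} (v : V) : R :=
  (choice.pickle v)%:R.

Lemma vertex_parameter_inj (V : countType) : injective (@vertex_parameter V).
Proof.
apply: inj_comp (pcan_inj choice.pickleK).
by apply: mulrIn; rewrite oner_eq0.
Qed.

Lemma isometry_with_moment_coordinates {V : countType} {d : nat}
    (X : metric_polyhedron R V) (degX : degenerate d (skeleton1 X)) :
  exists y : V -> 'rV[R]_d, simplicial_isometric_map X
    (barycentric_extension (fun v => of_null_coordinates
       (\row_(k < d) vertex_parameter v ^+ k.+1) (y v))).
Proof.
pose g a b : R := if skeleton1 X a b then squared_length X a b else 0.
have g_sym a b : g a b = g b a.
  rewrite /g skeleton1_sym; case: ifP => // /andP[_ baX].
  exact/esym/squared_length_sym.
have [y y_edges] := degenerate_edge_equations_solvable _ _ _ _ _ g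
  (skeleton1_sym X) (skeleton1_irr X) degX (@vertex_parameter_inj V) g_sym.
exists (fun v => \row_(k < d) y v k).
apply: isometry_of_edges => a b ab; rewrite pseudoscalar_null.
have := y_edges a b ab; rewrite /g ab => <-.
by apply: eq_bigr => k _; rewrite !mxE.
Qed.

End Realization.

Theorem theorem1 (R : realType) (V : countType) (d n : nat)
    (X : metric_polyhedron R V) (d_gt0 : (0 < d)%N)
    (dimX : dimensional n X) (degX : degenerate d (skeleton1 X)) :
  (exists F : (V -> R) -> minkowski R d, simplicial_isometric_map X F) /\
  ((2 * n + 1 <= d)%N ->
   exists F : (V -> R) -> minkowski R d, simplicial_isometric_embedding X F).
Proof.
have [y isometric] := isometry_with_moment_coordinates X degX.
split; first by eexists; exact: isometric.
move=> nd; eexists; split; first exact: isometric.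
by apply: moment_coordinates_injective nd;
  [exact: vertex_parameter_inj | case: dimX].
Qed.
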